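(* The set $D=\{k!\mid k\in\mathbb{Z}^+\}$ is not $2$-accessible.
   Context: For a set $D$ of positive integers, a $D$-diffsequence of length $k$ is a sequence of positive integers $a_1<a_2<\dots<a_k$ such that $a_i-a_{i-1}\in D$ for $i=2,3,\dots,k$. A set $D$ of positive integers is called $r$-accessible if every $r$-coloring of the positive integers contains arbitrarily long monochromatic $D$-diffsequences (that is, for every coloring with $r$ colors and every $k$ there is a monochromatic $D$-diffsequence of length at least $k$). *)

(* Defs.v *)
From mathcomp Require Import all_boot.

Set Implicit Arguments.
Unset Strict Implicit.
Unset Printing Implicit Defensive.

(* Sets of positive integers are predicates on nat. The strict increase makes
   the truncated subtraction exact, so only the positive members of D matter. *)
Definition diffsequence (D : nat -> Prop) (a : seq nat) : Prop :=
  (forall i, i < size a -> 0 < nth 0 a i) /\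
  (forall i, i.+1 < size a ->
     nth 0 a i < nth 0 a i.+1 /\ D (nth 0 a i.+1 - nth 0 a i)).

Definition monochromatic (r : nat) (c : nat -> 'I_r) (a : seq nat) : Prop :=
  exists x : 'I_r, forall n, n \in a -> c n = x.

(* Colorings are total on nat for convenience; the value at 0 is irrelevant
   because the terms of a diffsequence are positive. *)
Definition accessible (r : nat) (D : nat -> Prop) : Prop :=
  forall (c : nat -> 'I_r) (k : nat),
    exists a : seq nat,
      [/\ k <= size a, diffsequence D a & monochromatic c a].

Definition positive_factorials (d : nat) : Prop :=
  exists2 k : nat, 0 < k & d = k`!.

(* Main.v *)
(** For a real [alpha] whose multiples [k! * alpha] have fractional part in
    [[1/12, 1/2]] for every [k >= 1], colour [n] by the half of [[0, 1)] that
    contains the fractional part of [n * alpha].  A step by [k!] moves this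
    fractional part forward by at least 1/12 and by too little to jump over the
    other half, so a monochromatic diffsequence has bounded length.  The number
    [alpha = sum_j floor((j-1)/2) / j!] has this property. *)
Require Import Defs.
From mathcomp Require Import all_boot.
From mathcomp Require Import zify ring.

Set Implicit Arguments.
Unset Strict Implicit.
Unset Printing Implicit Defensive.

(* [alpha_num N / N!] is the [N]-th partial sum of the series for [alpha]. *)
Fixpoint alpha_num (N : nat) : nat :=
  if N is M.+1 then M.+1 * alpha_num M + M./2 else 0.

Lemma alpha_numS N : alpha_num N.+1 = N.+1 * alpha_num N + N./2.
Proof. by []. Qed.

(** The slack [k!] in the upper bound pays for the later terms: passing to [N.+1] multiplies it by
    [N.+1], a gain of [k! * N], and twice the new term is at most that. *)
Lemma fact_alpha_num k N : 0 < k -> k.+2 <= N ->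
  exists R, [/\ k`! * alpha_num N = alpha_num k * N`! + R,
                2 * R + k`! <= N`! & N`! <= 12 * R].
Proof.
move=> k_gt0; elim: N => // N IH; rewrite leq_eqVlt => /orP[/eqP[<-]|].
  (* The terms of orders [k+1] and [k+2]; the first alone vanishes for [k = 1]. *)
  exists (k`! * (k.+2 * k./2 + k.+1./2)); rewrite !alpha_numS !factS.
  set f := k`!; set A := alpha_num k; set h := k./2; set h' := k.+1./2.
  have [h_le h_ge hh'] : [/\ 2 * h <= k, k <= 2 * h + 1 & h + h' = k].
    have := odd_double_half k; have := odd_double_half k.+1.
    by rewrite -/h -/h' /= -!mul2n; case: odd => /= ? ?; split; lia.
  have -> : k.+2 * (k.+1 * f) = f * (k.+2 * k.+1) by ring.
  split; first by ring.
  - have -> : 2 * (f * (k.+2 * h + h')) + f = f * (2 * (k.+2 * h + h') + 1).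
      by ring.
    by rewrite leq_mul2l; apply/orP; right; nia.
  - by rewrite [12 * _]mulnCA leq_mul2l; apply/orP; right; nia.
rewrite ltnS => /IH[R [eqR ubR lbR]].
exists (N.+1 * R + k`! * N./2); rewrite alpha_numS factS.
have hN : 2 * N./2 <= N by rewrite mul2n -[leqRHS]odd_double_half leq_addl.
split.
- by rewrite mulnDr mulnCA eqR; ring.
- have : N.+1 * (2 * R + k`!) <= N.+1 * N`! by rewrite leq_mul2l ubR orbT.
  have : k`! * (2 * N./2) <= k`! * N by rewrite leq_mul2l hN orbT.
  by lia.
- have : N.+1 * N`! <= N.+1 * (12 * R) by rewrite leq_mul2l lbR orbT.
  by lia.
Qed.

(* The integer part of [2 n alpha], read off the partial sum of order [2 n]. *)
Definition half_turns (n : nat) : nat :=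
  (2 * n * alpha_num (2 * n)) %/ (2 * n)`!.

(* The partial sum times [2 n] has denominator dividing [N! / (2 n)], hence is
   too far below the next integer for the later terms to reach it. *)
Lemma half_turnsE n N : 0 < n -> 2 * n <= N ->
  half_turns n = (2 * n * alpha_num N) %/ N`!.
Proof.
move=> n_gt0; elim: N => [|N IH]; first by lia.
rewrite leq_eqVlt => /orP[/eqP <- //|]; rewrite ltnS => leN.
have n2_gt0 : 0 < 2 * n by rewrite muln_gt0.
have /dvdnP[M defM] : 2 * n %| N`! by apply: dvdn_fact; rewrite n2_gt0.
rewrite (IH leN) factS defM alpha_numS [M * _]mulnC (mulnCA N.+1).
rewrite !divnMl // divnMA.
rewrite (mulnC N.+1) divnMDl // (divn_small (_ : N./2 < N.+1)) ?addn0 //; lia.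
Qed.

(** The integer part of [2x] is twice that of [x], plus 1 exactly when the fractional part of [x] is
    at least 1/2. *)
Lemma odd_half_turns n N : 0 < n -> 2 * n <= N ->
  odd (half_turns n) = (N`! <= 2 * ((n * alpha_num N) %% N`!)).
Proof.
move=> n_gt0 leN; rewrite (half_turnsE n_gt0 leN) -mulnA.
have F_gt0 := fact_gt0 N.
rewrite {1}(divn_eq (n * alpha_num N) N`!) mulnDr mulnA divnMDl // oddD.
rewrite oddM /=; set u := _ %% _.
have u_lt : u < N`! by rewrite ltn_mod.
case: leqP => [le_u|lt_u]; last by rewrite divn_small.
have -> : 2 * u = 1 * N`! + (2 * u - N`!) by lia.
by rewrite divnMDl // divn_small //; lia.
Qed.

(** Wrapping around with [R] at most [F/2] would lead from the upper half to the lower one. *)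
Lemma modn_forward_step F u R : u < F -> 2 * R <= F ->
  (F <= 2 * u) = (F <= 2 * ((u + R) %% F)) -> (u + R) %% F = u + R.
Proof.
move=> u_lt R_le same.
have [lt_F|ge_F] := ltnP (u + R) F; first exact: modn_small.
have uR : (u + R) %% F = u + R - F.
  by rewrite -{1}(subnK ge_F) modnDr modn_small //; lia.
by move: same; rewrite uR; lia.
Qed.

Theorem proposition1p2 : ~ accessible 2 positive_factorials.
Proof.
(* Thirteen terms give twelve steps of at least 1/12 each: a full turn. *)
move=> /(_ (fun n => inord (odd (half_turns n))) 13).
case=> a [size_a [a_gt0 a_step] [x cx]].
(* One order for all terms; the [+ 2] ensures [k.+2 <= N] for each step [k!], as [k <= k!]. *)
pose N := 2 * (\max_(y <- a) y) + 2; pose F := N`!.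
pose u i := (nth 0 a i * alpha_num N) %% F.
have F_gt0 : 0 < F by apply: fact_gt0.
have u_lt i : u i < F by rewrite ltn_mod.
have leN i : i < size a -> 2 * nth 0 a i + 2 <= N.
  move=> lt_i; rewrite leq_add2r leq_mul //.
  exact: (@leq_bigmax_seq _ _ predT id _ (mem_nth 0 lt_i)).
have same i j : i < size a -> j < size a -> (F <= 2 * u i) = (F <= 2 * u j).
  move=> lt_i lt_j; have lei := leN _ lt_i; have lej := leN _ lt_j.
  rewrite /F /u -!odd_half_turns ?a_gt0 //; try lia.
  have := cx _ (mem_nth 0 lt_i); rewrite -(cx _ (mem_nth 0 lt_j)).
  move=> /(congr1 val); rewrite /= !inordK; try by case: odd.
  by do 2!case: odd.
have u_ge i : i < size a -> i * F <= 12 * u i.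
  elim: i => // i IH lt_i1; have lt_i := ltnW lt_i1.
  have [lt_a [k k_gt0 def_k]] := a_step i lt_i1.
  have leN1 := leN _ lt_i1.
  have k_le : k <= k`! by rewrite fact_geq.
  have [|R [eqR ubR lbR]] := @fact_alpha_num k N k_gt0; first by lia.
  have uS : u i.+1 = (u i + R) %% F.
    rewrite /u -[nth 0 a i.+1](subnKC (ltnW lt_a)) def_k mulnDl eqR.
    by rewrite addnCA modnMDl modnDml.
  have := same _ _ lt_i lt_i1; rewrite uS => /modn_forward_step -> //.
    by rewrite mulnDr mulSn addnC leq_add ?IH.
  by apply: leq_trans ubR; apply: leq_addr.
have := u_ge 12 size_a; have := u_lt 12; lia.
Qed.
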